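(* Let $k$ be a field of characteristic zero and $\lambda\in k$. Suppose that $\Omega^1$ is a four-dimensional right-covariant first order differential calculus over $k_\lambda[\mathrm{Heis}]$, with basis (as a left $k_\lambda[\mathrm{Heis}]$-module) $\{dX,dY,dt,\theta\}$, with $\theta a-a\theta=da$ for all $a\in k_\lambda[\mathrm{Heis}]$, and $\Delta_R(\theta)=\theta\otimes1$. Such an $\Omega^1$ cannot contain as a sub-bimodule the two dimensional calculus over $U_\lambda(\mathbf{b}_+)$ with left basis $\{dX,dY\}$ and relations $$(dX)X=X\,dX,\quad (dX)Y=(Y-\lambda/2)dX,\quad (dY)X=(\lambda/2)dX+X\,dY,\quad (dY)Y=(Y+\lambda/2)dY.$$
   Context: $k_\lambda[\mathrm{Heis}]$ is the Hopf algebra over $k$ generated by $X,Y,t$ with $[Y,X]=\lambda X$, $[X,t]=\frac12\lambda t^2$, $[Y,t]=\lambda t$, $\Delta(X)=X\otimes1+1\otimes X+Y\otimes t$, $Y,t$ primitive, $\varepsilon(X)=\varepsilon(Y)=\varepsilon(t)=0$. $U_\lambda(\mathbf{b}_+)$ is the unital algebra generated by $X,Y$ with $[Y,X]=\lambda X$, here the subalgebra of $k_\lambda[\mathrm{Heis}]$ generated by $X,Y$. For $\Omega^1$ to contain the two dimensional calculus means that the four displayed relations hold in $\Omega^1$. A first order differential calculus (FODC) over an algebra $\mathcal{A}$ is an $\mathcal{A}$-bimodule $\Omega^1$ with a linear map $d:\mathcal{A}\to\Omega^1$ satisfying $d(ab)=(da)b+a\,db$ and such that $\Omega^1$ is the linear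 span of elements $a\,db$. For a Hopf algebra $\mathcal{A}$, $\Omega^1$ is right covariant if there is a linear map $\Delta_R:\Omega^1\to\Omega^1\otimes\mathcal{A}$ with $\Delta_R(a\omega b)=\Delta(a)\Delta_R(\omega)\Delta(b)$ and $\Delta_R(da)=(d\otimes\mathrm{id})\Delta(a)$; thus $\Delta_R(dX)=dX\otimes1+dY\otimes t$, $\Delta_R(dY)=dY\otimes1$, $\Delta_R(dt)=dt\otimes1$.
   Formalization: The formal theorem assumes λ ≠ 0; for λ = 0 the claim as stated is false, since over the commutative algebra k[X,Y,t] there is such a calculus (with (dt)t = t dt + 3dt − 2θ) that satisfies the four relations. *)

(* Defs.v *)
From HB Require Import structures.
From mathcomp Require Import all_boot all_algebra.
From mathcomp Require Import boolp.

Set Implicit Arguments.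
Unset Strict Implicit.
Unset Printing Implicit Defensive.

Import GRing.Theory.
Local Open Scope ring_scope.
Local Open Scope quotient_scope.

Definition bilin (k : fieldType) (V W U : lmodType k) (f : V -> W -> U)
  (fP : bilinear_for *:%R *:%R f) : {bilinear V -> W -> U} :=
  HB.pack f (bilinear_isBilinear.Build k V W U *:%R *:%R f fP).

Definition mul_bilin_subproof (k : fieldType) (A : algType k) :
  bilinear_for *:%R *:%R (fun a b : A => a * b).
Proof.
split=> [b c x y | a c x y] /=; first by rewrite mulrDl scalerAl.
by rewrite mulrDr scalerAr.
Qed.

Definition mul_bilin (k : fieldType) (A : algType k) : {bilinear A -> A -> A} :=
  bilin (@mul_bilin_subproof k A).

(* The tensor product over k: a finite formal sum of pairs (v, w) stands for  *)
(* the sum of the v (x) w (scalars and signs being absorbed in v), and two    *)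
(* formal sums are identified when no bilinear map on V x W separates them.   *)
(* The universal property is tens_lift, tens_liftE and tens_ext.              *)
Section Tensor.
Variables (k : fieldType) (V W : lmodType k).

Definition formal_val (U : lmodType k) (f : {bilinear V -> W -> U})
    (s : seq (V * W)) : U :=
  \sum_(p <- s) f p.1 p.2.

Definition tens_eq (s s' : seq (V * W)) : bool :=
  `[< forall (U : lmodType k) (f : {bilinear V -> W -> U}),
        formal_val f s = formal_val f s' >].

Lemma tens_eq_equiv : equiv_class_of tens_eq.
Proof.
split=> [s | s s' | s' s s''].
- exact/asboolP.
- by apply/asboolP/asboolP => ss' U f; rewrite ss'.
- move=> /asboolP ss' /asboolP s's''; apply/asboolP => U f.
  by rewrite ss' s's''.
Qed.

Canonical tens_equiv_rel := EquivRelPack tens_eq_equiv.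

Definition tens : Type := {eq_quot tens_equiv_rel}.
HB.instance Definition _ := EqQuotient.on tens.
HB.instance Definition _ := Choice.on tens.

Definition tens_pure (v : V) (w : W) : tens := \pi_tens [:: (v, w)].

Definition tens_lift (U : lmodType k) (f : {bilinear V -> W -> U})
    (z : tens) : U :=
  formal_val f (repr z).

Lemma tens_lift_pi (U : lmodType k) (f : {bilinear V -> W -> U}) s :
  tens_lift f (\pi_tens s) = formal_val f s.
Proof.
rewrite /tens_lift; have /eqmodP/asboolP : repr (\pi_tens s) = s %[mod tens].
  by rewrite reprK.
exact.
Qed.

Lemma tens_sep (z z' : tens) :
  (forall (U : lmodType k) (f : {bilinear V -> W -> U}),
     tens_lift f z = tens_lift f z') -> z = z'.
Proof.
move=> zz'; rewrite -[z]reprK -[z']reprK; apply/eqmodP/asboolP => U f.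
exact: zz'.
Qed.

Definition tens_scale (c : k) (z : tens) : tens :=
  \pi_tens [seq (c *: p.1, p.2) | p <- repr z].
Definition tens_zero : tens := \pi_tens [::].
Definition tens_add (z z' : tens) : tens := \pi_tens (repr z ++ repr z').
Definition tens_opp (z : tens) : tens := tens_scale (-1) z.

Lemma tens_lift0 (U : lmodType k) (f : {bilinear V -> W -> U}) : tens_lift f tens_zero = 0.
Proof. by rewrite tens_lift_pi /formal_val big_nil. Qed.

Lemma tens_liftD (U : lmodType k) (f : {bilinear V -> W -> U}) z z' :
  tens_lift f (tens_add z z') = tens_lift f z + tens_lift f z'.
Proof. by rewrite tens_lift_pi /formal_val big_cat. Qed.

Lemma tens_liftZ (U : lmodType k) (f : {bilinear V -> W -> U}) c z :
  tens_lift f (tens_scale c z) = c *: tens_lift f z.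
Proof.
rewrite tens_lift_pi /formal_val big_map scaler_sumr.
by apply: eq_bigr => p _; rewrite linearZl_LR.
Qed.

Let liftE := (tens_lift0, tens_liftD, tens_liftZ).

Lemma tens_addA : associative tens_add.
Proof. by move=> x y z; apply: tens_sep => U f; rewrite !liftE addrA. Qed.
Lemma tens_addC : commutative tens_add.
Proof. by move=> x y; apply: tens_sep => U f; rewrite !liftE addrC. Qed.
Lemma tens_add0 : left_id tens_zero tens_add.
Proof. by move=> x; apply: tens_sep => U f; rewrite !liftE add0r. Qed.
Lemma tens_addN : left_inverse tens_zero tens_opp tens_add.
Proof.
by move=> x; apply: tens_sep => U f; rewrite !liftE scaleN1r addNr.
Qed.

HB.instance Definition _ :=
  GRing.isZmodule.Build tens tens_addA tens_addC tens_add0 tens_addN.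

Lemma tens_scaleA a b z : tens_scale a (tens_scale b z) = tens_scale (a * b) z.
Proof. by apply: tens_sep => U f; rewrite !liftE scalerA. Qed.
Lemma tens_scale1 : left_id 1 tens_scale.
Proof. by move=> z; apply: tens_sep => U f; rewrite !liftE scale1r. Qed.
Lemma tens_scaleDr : right_distributive tens_scale +%R.
Proof. by move=> a x y; apply: tens_sep => U f; rewrite !liftE scalerDr. Qed.
Lemma tens_scaleDl z : {morph tens_scale^~ z : a b / a + b}.
Proof. by move=> a b; apply: tens_sep => U f; rewrite !liftE scalerDl. Qed.

HB.instance Definition _ := GRing.Zmodule_isLmodule.Build k tens
  tens_scaleA tens_scale1 tens_scaleDr tens_scaleDl.

Lemma tens_lift_linear (U : lmodType k) (f : {bilinear V -> W -> U}) : linear (tens_lift f).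
Proof. by move=> c x y; rewrite [LHS]tens_liftD tens_liftZ. Qed.

HB.instance Definition _ (U : lmodType k) (f : {bilinear V -> W -> U}) :=
  GRing.isLinear.Build k tens U *:%R (tens_lift f) (tens_lift_linear f).

Lemma tens_liftE (U : lmodType k) (f : {bilinear V -> W -> U}) v w :
  tens_lift f (tens_pure v w) = f v w.
Proof. by rewrite tens_lift_pi /formal_val big_seq1. Qed.

Lemma tens_pure_bilinear : bilinear_for *:%R *:%R tens_pure.
Proof.
split=> [w c v v' | v c w w'] /=; apply: tens_sep => U f.
  by rewrite [RHS]linearP /= !tens_liftE linearPl.
by rewrite [RHS]linearP /= !tens_liftE linearPr.
Qed.

HB.instance Definition _ :=
  bilinear_isBilinear.Build k V W tens *:%R *:%R tens_pure tens_pure_bilinear.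

Lemma tens_span (z : tens) :
  exists s : seq (V * W), z = \sum_(p <- s) tens_pure p.1 p.2.
Proof.
exists (repr z); apply: tens_sep => U f.
rewrite linear_sum; apply: eq_bigr => p _; exact/esym/tens_liftE.
Qed.

Lemma tens_ind (P : tens -> Prop) :
    P 0 -> (forall v w, P (tens_pure v w)) ->
    (forall z z', P z -> P z' -> P (z + z')) ->
  forall z, P z.
Proof.
move=> P0 Ppure PD z; have [s ->] := tens_span z.
by elim/big_ind: _ => // p _; apply: Ppure.
Qed.

Lemma tens_lift_sum (U : lmodType k) (f : {bilinear V -> W -> U})
    (s : seq (V * W)) :
  tens_lift f (\sum_(p <- s) tens_pure p.1 p.2) = \sum_(p <- s) f p.1 p.2.
Proof.
by rewrite [LHS]linear_sum; apply: eq_bigr => p _; exact: tens_liftE.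
Qed.

Lemma tens_ext (U : lmodType k) (f g : {linear tens -> U}) :
  (forall v w, f (tens_pure v w) = g (tens_pure v w)) -> f =1 g.
Proof.
move=> fg z; have [s ->] := tens_span z; rewrite !linear_sum.
by apply: eq_bigr => p _; apply: fg.
Qed.

End Tensor.

Notation "v ⊗ w" := (tens_pure v w) (at level 38, left associativity).

Section TensorMap.
Variables (k : fieldType) (V W V' W' : lmodType k).
Variables (f : {linear V -> V'}) (g : {linear W -> W'}).

Lemma tens_map_subproof :
  bilinear_for *:%R *:%R (fun v w => f v ⊗ g w).
Proof.
split=> [w c v v' | v c w w'] /=; first by rewrite linearP linearPl.
by rewrite linearP linearPr.
Qed.

Definition tens_map : tens V W -> tens V' W' := tens_lift (bilin tens_map_subproof).
HB.instance Definition _ := GRing.Linear.on tens_map.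

Lemma tens_mapE v w : tens_map (v ⊗ w) = f v ⊗ g w.
Proof. exact: tens_liftE. Qed.

End TensorMap.

(* The bilinear map (v (x) w, v' (x) w') |-> f v v' (x) g w w'. *)
Section TensorMap2.
Variables (k : fieldType) (V1 V2 V3 W1 W2 W3 : lmodType k).
Variables (f : {bilinear V1 -> V2 -> V3}) (g : {bilinear W1 -> W2 -> W3}).

Lemma tens_map2_subproof1 v w :
  bilinear_for *:%R *:%R (fun v' w' => f v v' ⊗ g w w').
Proof.
split=> [w' c x y | v' c x y] /=; first by rewrite linearPr linearPl.
by rewrite linearPr linearPr.
Qed.

Lemma tens_map2_subproof2 z' :
  bilinear_for *:%R *:%R
    (fun v w => tens_lift (bilin (tens_map2_subproof1 v w)) z').
Proof.
have [s ->] := tens_span z'.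
split=> [w c x y | v c x y] /=; rewrite !tens_lift_sum scaler_sumr -big_split /=;
  apply: eq_bigr => p _.
  by rewrite linearPl linearPl.
by rewrite linearPl linearPr.
Qed.

Definition tens_map2 (z : tens V1 W1) (z' : tens V2 W2) : tens V3 W3 :=
  tens_lift (bilin (tens_map2_subproof2 z')) z.

Lemma tens_map2E v w v' w' :
  tens_map2 (v ⊗ w) (v' ⊗ w') = f v v' ⊗ g w w'.
Proof. by rewrite /tens_map2 tens_liftE /= tens_liftE. Qed.

Lemma tens_map2_bilinear : bilinear_for *:%R *:%R tens_map2.
Proof.
split=> [z' c x y | z c x y] /=; first by rewrite /tens_map2 [LHS]linearP.
have [s ->] := tens_span z; rewrite /tens_map2 !tens_lift_sum scaler_sumr.
by rewrite -big_split /=; apply: eq_bigr => p _; rewrite linearP.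
Qed.

HB.instance Definition _ := bilinear_isBilinear.Build k (tens V1 W1)
  (tens V2 W2) (tens V3 W3) *:%R *:%R tens_map2 tens_map2_bilinear.

End TensorMap2.

(* (a (x) b) (a' (x) b') = a a' (x) b b'. *)
Section TensorRing.
Variables (k : fieldType) (A B : algType k).

Definition tens_mul : tens A B -> tens A B -> tens A B :=
  tens_map2 (mul_bilin A) (mul_bilin B).
HB.instance Definition _ := Bilinear.on tens_mul.

Lemma tens_mulE a b a' b' : tens_mul (a ⊗ b) (a' ⊗ b') = (a * a') ⊗ (b * b').
Proof. exact: tens_map2E. Qed.

Lemma tens_mulA : associative tens_mul.
Proof.
move=> x y z; elim/tens_ind: x => [|a b|x x' IH IH']; first by rewrite !linear0l.
  elim/tens_ind: y => [|a' b'|y y' IH IH'].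
  - by rewrite linear0l linear0r linear0l.
  - elim/tens_ind: z => [|a'' b''|z z' IH IH']; first by rewrite !linear0r.
      by rewrite !tens_mulE !mulrA.
    by rewrite !linearDr /= IH IH'.
  - by rewrite linearDl !linearDr linearDl /= IH IH'.
by rewrite !linearDl /= IH IH'.
Qed.

Lemma tens_mul1 : left_id (1 ⊗ 1) tens_mul.
Proof.
elim/tens_ind => [|a b|z z' IH IH']; first by rewrite linear0r.
  by rewrite tens_mulE !mul1r.
by rewrite linearDr /= IH IH'.
Qed.

Lemma tens_1mul : right_id (1 ⊗ 1) tens_mul.
Proof.
elim/tens_ind => [|a b|z z' IH IH']; first by rewrite linear0l.
  by rewrite tens_mulE !mulr1.
by rewrite linearDl /= IH IH'.
Qed.

Lemma tens_mulDl : left_distributive tens_mul +%R.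
Proof. by move=> x y z; rewrite linearDl. Qed.
Lemma tens_mulDr : right_distributive tens_mul +%R.
Proof. by move=> x y z; rewrite linearDr. Qed.

HB.instance Definition _ := GRing.Zmodule_isPzRing.Build (tens A B)
  tens_mulA tens_mul1 tens_1mul tens_mulDl tens_mulDr.

Lemma tens_pureM (a a' : A) (b b' : B) :
  (a ⊗ b) * (a' ⊗ b') = (a * a') ⊗ (b * b').
Proof. exact: tens_mulE. Qed.

End TensorRing.

Section TensorAlgebra.
Variables (k : fieldType) (A B : algType k).

Lemma tens_scalerAl (c : k) (x y : tens A B) : c *: (x * y) = (c *: x) * y.
Proof. exact/esym/(linearZl_LR (@tens_mul k A B)). Qed.

Lemma tens_scalerAr (c : k) (x y : tens A B) : c *: (x * y) = x * (c *: y).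
Proof. exact/esym/(linearZr_LR (@tens_mul k A B)). Qed.

End TensorAlgebra.

(* k_lambda[Heis]: noncommutative polynomial expressions in X, Y, t, two of   *)
(* them being identified when the defining relations force it, that is when   *)
(* they agree in every k-algebra with elements x, y, t satisfying the         *)
(* relations. The universal property is heis_lift, heis_lift_gen, heis_ext.   *)
Definition heis_rel (k : fieldType) (lambda : k) (B : algType k) (x y t : B) :=
  [/\ y * x - x * y = lambda *: x,
      x * t - t * x = (lambda / 2) *: t ^+ 2
    & y * t - t * y = lambda *: t].

Inductive heis_expr (k : Type) : Type :=
| EX | EY | Et | EC of k
| EAdd of heis_expr k & heis_expr k
| EMul of heis_expr k & heis_expr k.

HB.instance Definition _ (k : Type) := gen_eqMixin (heis_expr k).
HB.instance Definition _ (k : Type) := gen_choiceMixin (heis_expr k).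

Fixpoint heis_eval (k : fieldType) (B : algType k) (x y t : B)
    (e : heis_expr k) : B :=
  match e with
  | EX => x | EY => y | Et => t
  | EC c => c%:A
  | EAdd e1 e2 => heis_eval x y t e1 + heis_eval x y t e2
  | EMul e1 e2 => heis_eval x y t e1 * heis_eval x y t e2
  end.

Section Heis.
Variables (k : fieldType) (lambda : k).

Definition heis_eq (e e' : heis_expr k) : bool :=
  `[< forall (B : algType k) (x y t : B), heis_rel lambda x y t ->
        heis_eval x y t e = heis_eval x y t e' >].

Lemma heis_eq_equiv : equiv_class_of heis_eq.
Proof.
split=> [e | e e' | e' e e''].
- exact/asboolP.
- by apply/asboolP/asboolP => ee' B x y t H; rewrite ee'.
- move=> /asboolP ee' /asboolP e'e''; apply/asboolP => B x y t H.
  by rewrite ee' // e'e''.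
Qed.

Canonical heis_equiv_rel := EquivRelPack heis_eq_equiv.

Definition heis : Type := {eq_quot heis_equiv_rel}.
HB.instance Definition _ := EqQuotient.on heis.
HB.instance Definition _ := Choice.on heis.

Definition heisX : heis := \pi_heis (EX k).
Definition heisY : heis := \pi_heis (EY k).
Definition heist : heis := \pi_heis (Et k).

Definition heis_val (B : algType k) (x y t : B) (a : heis) : B :=
  heis_eval x y t (repr a).

Lemma heis_val_pi (B : algType k) (x y t : B) e :
  heis_rel lambda x y t -> heis_val x y t (\pi_heis e) = heis_eval x y t e.
Proof.
move=> H; rewrite /heis_val.
have /eqmodP/asboolP : repr (\pi_heis e) = e %[mod heis] by rewrite reprK.
exact.
Qed.

Lemma heis_sep (a b : heis) :
  (forall (B : algType k) (x y t : B), heis_rel lambda x y t ->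
     heis_val x y t a = heis_val x y t b) -> a = b.
Proof.
move=> ab; rewrite -[a]reprK -[b]reprK; apply/eqmodP/asboolP => B x y t H.
exact: ab.
Qed.

Definition heis_const (c : k) : heis := \pi_heis (EC c).
Definition heis_add (a b : heis) : heis := \pi_heis (EAdd (repr a) (repr b)).
Definition heis_mul (a b : heis) : heis := \pi_heis (EMul (repr a) (repr b)).
Definition heis_scale (c : k) (a : heis) : heis := heis_mul (heis_const c) a.
Definition heis_opp (a : heis) : heis := heis_scale (-1) a.

Section Val.
Variables (B : algType k) (x y t : B) (H : heis_rel lambda x y t).

Lemma heis_valC c : heis_val x y t (heis_const c) = c%:A.
Proof. exact: heis_val_pi. Qed.
Lemma heis_valD a b :
  heis_val x y t (heis_add a b) = heis_val x y t a + heis_val x y t b.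
Proof. exact: heis_val_pi. Qed.
Lemma heis_valM a b :
  heis_val x y t (heis_mul a b) = heis_val x y t a * heis_val x y t b.
Proof. exact: heis_val_pi. Qed.
Lemma heis_valZ c a : heis_val x y t (heis_scale c a) = c *: heis_val x y t a.
Proof. by rewrite heis_valM heis_valC mulr_algl. Qed.
Lemma heis_valN a : heis_val x y t (heis_opp a) = - heis_val x y t a.
Proof. by rewrite heis_valZ scaleN1r. Qed.

Definition heis_valE := (heis_valN, heis_valZ, heis_valC, heis_valD, heis_valM).
End Val.

Lemma heis_addA : associative heis_add.
Proof. by move=> a b c; apply: heis_sep => B x y t H; rewrite !heis_valE ?addrA. Qed.
Lemma heis_addC : commutative heis_add.
Proof. by move=> a b; apply: heis_sep => B x y t H; rewrite !heis_valE // addrC. Qed.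
Lemma heis_add0 : left_id (heis_const 0) heis_add.
Proof.
by move=> a; apply: heis_sep => B x y t H; rewrite !heis_valE // scale0r add0r.
Qed.
Lemma heis_addN : left_inverse (heis_const 0) heis_opp heis_add.
Proof.
by move=> a; apply: heis_sep => B x y t H; rewrite !heis_valE // scale0r addNr.
Qed.

HB.instance Definition _ :=
  GRing.isZmodule.Build heis heis_addA heis_addC heis_add0 heis_addN.

Lemma heis_mulA : associative heis_mul.
Proof. by move=> a b c; apply: heis_sep => B x y t H; rewrite !heis_valE ?mulrA. Qed.
Lemma heis_mul1 : left_id (heis_const 1) heis_mul.
Proof.
by move=> a; apply: heis_sep => B x y t H; rewrite !heis_valE // scale1r mul1r.
Qed.
Lemma heis_1mul : right_id (heis_const 1) heis_mul.
Proof.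
by move=> a; apply: heis_sep => B x y t H; rewrite !heis_valE // scale1r mulr1.
Qed.
Lemma heis_mulDl : left_distributive heis_mul heis_add.
Proof.
by move=> a b c; apply: heis_sep => B x y t H; rewrite !heis_valE // mulrDl.
Qed.
Lemma heis_mulDr : right_distributive heis_mul heis_add.
Proof.
by move=> a b c; apply: heis_sep => B x y t H; rewrite !heis_valE // mulrDr.
Qed.

Lemma heis_rel0 : heis_rel lambda (0 : k^o) 0 0.
Proof. by split; rewrite ?expr0n ?mulr0 ?subr0 ?scaler0. Qed.

Lemma heis_1neq0 : heis_const 1 != heis_const 0.
Proof.
apply/eqP => /(congr1 (heis_val (0 : k^o) 0 0)).
rewrite !(heis_valC heis_rel0) scale1r scale0r => /eqP.
by rewrite oner_eq0.
Qed.

HB.instance Definition _ := GRing.Zmodule_isNzRing.Build heis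
  heis_mulA heis_mul1 heis_1mul heis_mulDl heis_mulDr heis_1neq0.

Lemma heis_scaleA a b z : heis_scale a (heis_scale b z) = heis_scale (a * b) z.
Proof. by apply: heis_sep => B x y t H; rewrite !heis_valE ?scalerA. Qed.
Lemma heis_scale1 : left_id 1 heis_scale.
Proof. by move=> z; apply: heis_sep => B x y t H; rewrite !heis_valE ?scale1r. Qed.
Lemma heis_scaleDr : right_distributive heis_scale heis_add.
Proof.
by move=> a z z'; apply: heis_sep => B x y t H; rewrite !heis_valE ?scalerDr.
Qed.
Lemma heis_scaleDl z : {morph heis_scale^~ z : a b / a + b >-> heis_add a b}.
Proof.
by move=> a b; apply: heis_sep => B x y t H; rewrite !heis_valE ?scalerDl.
Qed.

HB.instance Definition _ := GRing.Zmodule_isLmodule.Build k heis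
  heis_scaleA heis_scale1 heis_scaleDr heis_scaleDl.

Lemma heis_scaleAl c (a b : heis) : c *: (a * b) = (c *: a) * b.
Proof. by apply: heis_sep => B x y t H; rewrite !heis_valE ?scalerAl. Qed.

HB.instance Definition _ := GRing.Lmodule_isLalgebra.Build k heis heis_scaleAl.

Lemma heis_scaleAr c (a b : heis) : c *: (a * b) = a * (c *: b).
Proof. by apply: heis_sep => B x y t H; rewrite !heis_valE ?scalerAr. Qed.

HB.instance Definition _ := GRing.Lalgebra_isAlgebra.Build k heis heis_scaleAr.

Lemma heis_relXYt : heis_rel lambda heisX heisY heist.
Proof.
split; apply: heis_sep => B x y t H; rewrite ?expr2 !heis_valE // !heis_val_pi //;
  by case: H.
Qed.

Section Lift.
Variables (B : algType k) (x y t : B) (H : heis_rel lambda x y t).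

(* The only use of the argument H is to make the map an algebra morphism.     *)
Definition heis_lift_fun of heis_rel lambda x y t := heis_val x y t.

Lemma heis_lift_linear : linear (heis_lift_fun H).
Proof. by move=> c a b; rewrite [LHS]heis_valD // heis_valZ. Qed.
HB.instance Definition _ :=
  GRing.isLinear.Build k heis B *:%R (heis_lift_fun H) heis_lift_linear.

Lemma heis_lift_monoid : monoid_morphism (heis_lift_fun H).
Proof.
by split=> [|a b]; [rewrite [LHS]heis_valC // scale1r | exact: heis_valM].
Qed.
HB.instance Definition _ :=
  GRing.isMonoidMorphism.Build heis B (heis_lift_fun H) heis_lift_monoid.

Definition heis_lift : {lrmorphism heis -> B} := heis_lift_fun H.

Lemma heis_lift_gen :
  [/\ heis_lift heisX = x, heis_lift heisY = y & heis_lift heist = t].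
Proof. by split; apply: heis_val_pi. Qed.

End Lift.

Lemma heis_ind (P : heis -> Prop) :
    P heisX -> P heisY -> P heist -> (forall c : k, P c%:A) ->
    (forall a b, P a -> P b -> P (a + b)) ->
    (forall a b, P a -> P b -> P (a * b)) ->
  forall a, P a.
Proof.
move=> PX PY Pt PC PD PM a; rewrite -[a]reprK.
elim: (repr a) => //= [c|e IH e' IH'|e IH e' IH'].
- suff -> : \pi_heis (EC c) = c%:A by [].
  by apply: heis_sep => B x y t H; rewrite !heis_valE // scale1r.
- suff -> : \pi_heis (EAdd e e') = \pi_heis e + \pi_heis e' by apply: PD.
  by apply: heis_sep => B x y t H; rewrite !heis_valE // !heis_val_pi.
- suff -> : \pi_heis (EMul e e') = \pi_heis e * \pi_heis e' by apply: PM.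
  by apply: heis_sep => B x y t H; rewrite !heis_valE // !heis_val_pi.
Qed.

Lemma heis_ext (B : algType k) (f g : {lrmorphism heis -> B}) :
  f heisX = g heisX -> f heisY = g heisY -> f heist = g heist -> f =1 g.
Proof.
move=> fX fY ft; elim/heis_ind => // [c|a b IH IH'|a b IH IH'].
- by rewrite !linearZ /= !rmorph1.
- by rewrite !raddfD /= IH IH'.
- by rewrite !rmorphM /= IH IH'.
Qed.

Definition heis_counit : {lrmorphism heis -> k^o} := heis_lift heis_rel0.

End Heis.

Arguments heisX {k lambda}.
Arguments heisY {k lambda}.
Arguments heist {k lambda}.

Section HeisCoproduct.
Variables (k : fieldType) (lambda : k).
Local Notation H := (heis lambda).

Lemma counit2_subproof :
  bilinear_for *:%R *:%R
    (fun a b : H => (heis_counit lambda a * heis_counit lambda b : k^o)).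
Proof.
split=> [b c x y | a c x y] /=; rewrite linearP.
  by rewrite mulrDl scalerAl.
by rewrite mulrDr scalerAr.
Qed.

Lemma heis2_1neq0 : (1 : tens H H) != 0.
Proof.
apply/eqP => /(congr1 (tens_lift (bilin counit2_subproof))).
rewrite [LHS]tens_liftE /= !rmorph1 mulr1 linear0 => /eqP.
by rewrite oner_eq0.
Qed.

HB.instance Definition _ :=
  GRing.PzSemiRing_isNonZero.Build (tens H H) heis2_1neq0.
HB.instance Definition _ := GRing.Lmodule_isLalgebra.Build k (tens H H)
  (@tens_scalerAl k H H).
HB.instance Definition _ := GRing.Lalgebra_isAlgebra.Build k (tens H H)
  (@tens_scalerAr k H H).

Hypothesis char0 : [pchar k] =i pred0.

Let X : H := heisX.
Let Y : H := heisY.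
Let t : H := heist.

Let comm (B : pzRingType) (x y : B) := x * y - y * x.

Let commDl (B : pzRingType) (x x' y : B) :
  comm (x + x') y = comm x y + comm x' y.
Proof. by rewrite /comm mulrDl mulrDr opprD addrACA. Qed.

Let commDr (B : pzRingType) (x y y' : B) :
  comm x (y + y') = comm x y + comm x y'.
Proof. by rewrite /comm mulrDl mulrDr opprD addrACA. Qed.

Let comm_1r (a b c : H) : comm (a ⊗ 1) (b ⊗ c) = comm a b ⊗ c.
Proof. by rewrite /comm !tens_pureM mul1r mulr1 linearBl. Qed.

Let comm_1l (a b c : H) : comm (1 ⊗ a) (b ⊗ c) = b ⊗ comm a c.
Proof. by rewrite /comm !tens_pureM mul1r mulr1 linearBr. Qed.

Let comm_r1 (a b c : H) : comm (b ⊗ c) (a ⊗ 1) = comm b a ⊗ c.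
Proof. by rewrite /comm !tens_pureM mul1r mulr1 linearBl. Qed.

Let comm_r2 (a b c : H) : comm (b ⊗ c) (1 ⊗ a) = b ⊗ comm c a.
Proof. by rewrite /comm !tens_pureM mul1r mulr1 linearBr. Qed.

Let comm_1 (a : H) : comm a 1 = 0.
Proof. by rewrite /comm mul1r mulr1 subrr. Qed.

Let comm_id (a : H) : comm a a = 0.
Proof. by rewrite /comm subrr. Qed.

Lemma heis_coproduct_subproof :
  heis_rel lambda (X ⊗ 1 + 1 ⊗ X + Y ⊗ t) (Y ⊗ 1 + 1 ⊗ Y) (t ⊗ 1 + 1 ⊗ t).
Proof.
have [YX Xt Yt] := heis_relXYt lambda.
have lambda2 : lambda = lambda / 2 + lambda / 2.
  by rewrite -mulr2n -[RHS]mulr_natr divfK // ((pcharf0P k).1 char0).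
split; rewrite -/(comm _ _) !(commDl, commDr).
- rewrite !(comm_1r, comm_1l) !comm_1 !comm_id !(linear0l, linear0r).
  rewrite /comm YX Yt !(add0r, addr0) !scalerDr.
  by rewrite linearZl_LR !linearZr_LR /= addrA.
- rewrite !comm_1r !comm_1l !comm_r1 !comm_r2 !comm_1 !comm_id !(linear0l, linear0r).
  rewrite /comm Xt Yt !(add0r, addr0) linearZl_LR linearZr_LR /= linearZl_LR.
  rewrite !expr2 mulrDl !mulrDr !tens_pureM !mul1r !mulr1.
  rewrite !scalerDr -!addrA; congr (_ + _).
  by rewrite [RHS]addrA -scalerDl -lambda2 addrC.
- rewrite !(comm_1r, comm_1l) !comm_1 !(linear0l, linear0r).
  by rewrite /comm Yt !(add0r, addr0) !scalerDr linearZr_LR /= linearZl_LR.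
Qed.

(* Delta X = X (x) 1 + 1 (x) X + Y (x) t, with Y and t primitive. *)
Definition heis_coproduct : {lrmorphism H -> tens H H} :=
  heis_lift heis_coproduct_subproof.

End HeisCoproduct.

Section Calculus.
Variable k : fieldType.

Record bimodule (A : algType k) : Type := Bimodule {
  bimod_sort :> lmodType k;
  lact : {bilinear A -> bimod_sort -> bimod_sort};
  ract : {bilinear bimod_sort -> A -> bimod_sort};
  lact1 : forall w, lact 1 w = w;
  lactM : forall a b w, lact (a * b) w = lact a (lact b w);
  ract1 : forall w, ract w 1 = w;
  ractM : forall a b w, ract w (a * b) = ract (ract w a) b;
  lractA : forall a w b, ract (lact a w) b = lact a (ract w b)
}.

Record fodc (A : algType k) : Type := Fodc {
  forms :> bimodule A;
  diff : {linear A -> forms};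
  diffM : forall a b, diff (a * b) = ract forms (diff a) b + lact forms a (diff b);
  diff_span : forall w : forms, exists s : seq (A * A),
    w = \sum_(p <- s) lact forms p.1 (diff p.2)
}.

(* (a (x) b) (w (x) c) = a w (x) b c and (w (x) c) (a (x) b) = w a (x) c b. *)
Definition tens_lact (A B : algType k) (M : bimodule A) :
    tens A B -> tens M B -> tens M B :=
  tens_map2 (lact M) (mul_bilin B).
Definition tens_ract (A B : algType k) (M : bimodule A) :
    tens M B -> tens A B -> tens M B :=
  tens_map2 (ract M) (mul_bilin B).

Definition right_covariant (A : algType k) (Delta : A -> tens A A)
    (M : fodc A) (DeltaR : {linear M -> tens M A}) : Prop :=
  (forall a w b, DeltaR (ract M (lact M a w) b) =
     tens_ract (tens_lact (Delta a) (DeltaR w)) (Delta b)) /\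
  (forall a, DeltaR (diff M a) = tens_map (diff M) idfun (Delta a)).

Definition left_basis (A : algType k) (M : bimodule A) (n : nat)
    (e : n.-tuple M) : Prop :=
  forall w : M, exists! c : {ffun 'I_n -> A},
    w = \sum_(i < n) lact M (c i) (tnth e i).

(* The relations of the two-dimensional calculus over the subalgebra          *)
(* U_lambda(b_+) generated by X and Y.                                        *)
Definition contains_2d_calculus (lambda : k) (M : fodc (heis lambda)) : Prop :=
  let X := heisX in let Y := heisY in
  let dX := diff M X in let dY := diff M Y in
  [/\ ract M dX X = lact M X dX,
      ract M dX Y = lact M (Y - (lambda / 2)%:A) dX,
      ract M dY X = (lambda / 2) *: dX + lact M X dY
    & ract M dY Y = lact M (Y + (lambda / 2)%:A) dY].

End Calculus.

(* Main.v *)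
From HB Require Import structures.
Require Import Defs.
From mathcomp Require Import all_boot all_algebra.
From mathcomp Require Import boolp ring.
Import GRing.Theory.
Local Open Scope ring_scope.

Set Implicit Arguments.
Unset Strict Implicit.

(** Write [w, p] = w p - p w, and suppose that the four relations of the
    two-dimensional calculus hold. The coefficients of dt and theta in a
    coinvariant form are scalars, and commutators of coinvariant forms with the
    primitive elements Y and t are again coinvariant. For coinvariant w the
    theta-coefficient of [w, Y] vanishes; since [[w, t], Y] is a multiple of
    [w, t] whenever [w, Y] is a multiple of w, a weight argument kills the
    theta-coefficients of [dX, t], [dY, t] and [dt, t], hence also those of
    [dt, X] and [dt, Y]. So the left span of dX, dY, dt is a sub-bimodule; it
    then contains every a db, whereas it does not contain theta. *)

(** * Commutators and left coordinates in a bimodule *)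

Section Bimodule.
Variables (k : fieldType) (A : algType k) (M : bimodule A).

Lemma lact_scalar (c : k) (w : M) : lact M c%:A w = c *: w.
Proof. by rewrite linearZl_LR lact1. Qed.

Lemma ract_scalar (c : k) (w : M) : ract M w c%:A = c *: w.
Proof. by rewrite linearZr_LR ract1. Qed.

Definition bimod_ad (p : A) (w : M) : M := ract M w p - lact M p w.

Lemma bimod_ad_linear p : linear (bimod_ad p).
Proof.
move=> c w w'; rewrite /bimod_ad linearPl linearPr /= scalerBr opprD.
by rewrite addrACA.
Qed.

HB.instance Definition _ p :=
  GRing.isLinear.Build k M M *:%R (bimod_ad p) (bimod_ad_linear p).

Lemma bimod_adD p w w' :
  bimod_ad p (w + w') = bimod_ad p w + bimod_ad p w'.
Proof. exact: linearD. Qed.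

Lemma bimod_adB p w w' :
  bimod_ad p (w - w') = bimod_ad p w - bimod_ad p w'.
Proof. exact: linearB. Qed.

Lemma bimod_adZ p c w : bimod_ad p (c *: w) = c *: bimod_ad p w.
Proof. exact: linearZ. Qed.

Lemma bimod_ad_scale c p w : bimod_ad (c *: p) w = c *: bimod_ad p w.
Proof. by rewrite /bimod_ad linearZr_LR linearZl_LR /= scalerBr. Qed.

Lemma ract_ad p w : ract M w p = bimod_ad p w + lact M p w.
Proof. by rewrite subrK. Qed.

Lemma bimod_ad_lact p a w :
  bimod_ad p (lact M a w) = lact M a (bimod_ad p w) + lact M (a * p - p * a) w.
Proof.
by rewrite /bimod_ad lractA linearBr linearBl /= !lactM [RHS]addrA subrK.
Qed.

Lemma bimod_ad_ract p a w :
  bimod_ad p (ract M w a) = ract M (bimod_ad p w) a + ract M w (a * p - p * a).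
Proof.
rewrite /bimod_ad linearBr linearBl /= !ractM lractA [RHS]addrC.
by rewrite [RHS]addrA subrK.
Qed.

(** The Jacobi identity; it carries a weight for [Y] across a commutator with [t]. *)
Lemma bimod_ad_ad p q w :
  bimod_ad q (bimod_ad p w) =
  bimod_ad p (bimod_ad q w) + bimod_ad (p * q - q * p) w.
Proof.
rewrite {2}/bimod_ad linearB /= bimod_ad_ract bimod_ad_lact.
by rewrite [in RHS]/bimod_ad opprD addrACA.
Qed.

Lemma scalar_comm (c : k) (a : A) : c%:A * a - a * c%:A = 0.
Proof. by rewrite mulr_algl mulr_algr subrr. Qed.

Section Coordinates.
Variables (n : nat) (e : n.-tuple M) (eP : left_basis e).

Definition coords (w : M) : {ffun 'I_n -> A} := projT1 (cid (eP w)).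

Definition coord (i : 'I_n) (w : M) : A := coords w i.

Lemma coord_sum w : w = \sum_(i < n) lact M (coord i w) (tnth e i).
Proof. by rewrite {1}(proj1 (projT2 (cid (eP w)))). Qed.

Lemma coord_unique (c : 'I_n -> A) w i :
  w = \sum_(i < n) lact M (c i) (tnth e i) -> coord i w = c i.
Proof.
move=> wE; rewrite /coord (_ : coords w = [ffun i => c i]) ?ffunE //.
apply: (proj2 (projT2 (cid (eP w)))); rewrite {1}wE.
by apply: eq_bigr => j _; rewrite ffunE.
Qed.

Lemma coord_linear i : linear (coord i).
Proof.
move=> c w w'; apply: (coord_unique (c := fun i => c *: coord i w + coord i w')).
rewrite {1}[w]coord_sum {1}[w']coord_sum scaler_sumr -big_split /=.
by apply: eq_bigr => j _; rewrite linearPl.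
Qed.

HB.instance Definition _ i :=
  GRing.isLinear.Build k M A *:%R (coord i) (coord_linear i).

Lemma coord_lact i a w : coord i (lact M a w) = a * coord i w.
Proof.
apply: (coord_unique (c := fun i => a * coord i w)).
rewrite {1}[w]coord_sum linear_sum.
by apply: eq_bigr => j _; rewrite lactM.
Qed.

Lemma coord_basis i j : coord i (tnth e j) = (i == j)%:R.
Proof.
apply: (coord_unique (c := fun i => (i == j)%:R)).
rewrite (bigD1 j) //= eqxx lact1 big1 ?addr0 // => l /negbTE ->.
by rewrite linear0l.
Qed.

(** Leibniz rule applied to the basis expansion of [w]; the last term comes from the commutators of
    the coefficients with [p]. *)
Lemma coord_ad i p w :
  coord i (bimod_ad p w) =
  \sum_(j < n) coord j w * coord i (bimod_ad p (tnth e j)) +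
  (coord i w * p - p * coord i w).
Proof.
rewrite {1}[w]coord_sum !linear_sum /=.
under eq_bigr => j _ do rewrite bimod_ad_lact linearD /= !coord_lact coord_basis.
rewrite big_split /=; congr (_ + _).
rewrite (bigD1 i) //= eqxx mulr1 big1 ?addr0 // => j ji.
by rewrite eq_sym (negbTE ji) mulr0.
Qed.

End Coordinates.
End Bimodule.

Section Fodc.
Variables (k : fieldType) (A : algType k) (M : fodc A).

Lemma diff1 : diff M 1 = 0.
Proof.
by apply: (addrI (diff M 1)); rewrite addr0 -{3}[1]mulr1 diffM ract1 lact1.
Qed.

Lemma diff_scalar (c : k) : diff M c%:A = 0.
Proof. by rewrite linearZ /= diff1 scaler0. Qed.

Lemma diff_comm a b :
  diff M (a * b - b * a) = bimod_ad b (diff M a) - bimod_ad a (diff M b).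
Proof.
rewrite linearB /= !diffM /bimod_ad !opprD !opprK.
by rewrite addrACA [RHS]addrACA [X in _ + X = _]addrC.
Qed.

End Fodc.

(** * Applying a functional to the first tensor factor *)

Section Slice.
Variables (k : fieldType) (V W : lmodType k) (f : {linear V -> k^o}).

Lemma slice_subproof :
  bilinear_for *:%R *:%R (fun (v : V) (w : W) => (f v : k) *: w).
Proof.
split=> [w c v v' | v c w w'] /=; first by rewrite linearP scalerDl scalerA.
by rewrite scalerDr !scalerA mulrC.
Qed.

Definition slice : tens V W -> W := tens_lift (bilin slice_subproof).
HB.instance Definition _ := GRing.Linear.on slice.

Lemma sliceE v w : slice (v ⊗ w) = (f v : k) *: w.
Proof. exact: tens_liftE. Qed.

End Slice.

HB.instance Definition _ (k : fieldType) (A B : algType k) (M : bimodule A) :=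
  Bilinear.on (@tens_lact k A B M).
HB.instance Definition _ (k : fieldType) (A B : algType k) (M : bimodule A) :=
  Bilinear.on (@tens_ract k A B M).

(** Meant for [f = eps \o coord i] and [v] a basis form, where [c] is a Kronecker delta: coordinates
    are left linear, so only the counit of the acting factor survives. *)
Lemma slice_lact (k : fieldType) (A B : algType k) (M : bimodule A)
    (eps : {linear A -> k^o}) (f : {linear M -> k^o}) (v : M) (c : k) :
  (forall a, f (lact M a v) = c * (eps a : k)) ->
  forall z (b : B), slice f (tens_lact z (v ⊗ b)) = c *: (slice eps z * b).
Proof.
move=> fv z b; elim/tens_ind: z => [|a b'|z z' IH IH'].
- by rewrite linear0l !linear0 mul0r scaler0.
- by rewrite /tens_lact tens_map2E !sliceE /= fv -scalerAl scalerA.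
by rewrite linearDl !linearD /= IH IH' mulrDl scalerDr.
Qed.

(** * Coinvariant forms and primitive elements *)

Section Coinvariant.
Variables (k : fieldType) (A : algType k) (Delta : A -> tens A A).
Variables (M : fodc A) (DeltaR : {linear M -> tens M A}).
Hypothesis Delta1 : Delta 1 = 1 ⊗ 1.
Hypothesis cov : right_covariant Delta DeltaR.

Lemma tens_lact1 (z : tens M A) : tens_lact (1 ⊗ 1 : tens A A) z = z.
Proof.
elim/tens_ind: z => [|w b|z z' IH IH']; first exact: linear0r.
  by rewrite /tens_lact tens_map2E lact1 /= mul1r.
by rewrite linearDr /= IH IH'.
Qed.

Lemma tens_ract1 (z : tens M A) : tens_ract z (1 ⊗ 1 : tens A A) = z.
Proof.
elim/tens_ind: z => [|w b|z z' IH IH']; first exact: linear0l.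
  by rewrite /tens_ract tens_map2E ract1 /= mulr1.
by rewrite linearDl /= IH IH'.
Qed.

Lemma cov_lact a w : DeltaR (lact M a w) = tens_lact (Delta a) (DeltaR w).
Proof. by rewrite -[lact M a w]ract1 cov.1 Delta1 tens_ract1. Qed.

Lemma cov_ract w a : DeltaR (ract M w a) = tens_ract (DeltaR w) (Delta a).
Proof. by rewrite -{1}[w]lact1 cov.1 Delta1 tens_lact1. Qed.

Definition primitive (p : A) := Delta p = p ⊗ 1 + 1 ⊗ p.

Definition coinvariant (w : M) := DeltaR w = w ⊗ 1.

(** The two actions of [1 ⊗ p] on [w ⊗ 1] both give [w ⊗ p], which cancels in the commutator. *)
Lemma coinvariant_ad p w :
  primitive p -> coinvariant w -> coinvariant (bimod_ad p w).
Proof.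
rewrite /coinvariant => pP wP.
rewrite linearB /= cov_lact cov_ract pP wP.
rewrite linearDl linearDr /= /tens_lact /tens_ract !tens_map2E /=.
rewrite !lact1 !ract1 !mul1r !mulr1.
by rewrite linearBl /= opprD addrACA subrr addr0.
Qed.

Lemma cov_diff_primitive p : primitive p -> coinvariant (diff M p).
Proof.
move=> pP; rewrite /coinvariant cov.2 pP linearD /= !tens_mapE.
by rewrite diff1 linear0l addr0.
Qed.

End Coinvariant.

(** * Counit and coproduct of the Heisenberg Hopf algebra *)

Section Heisenberg.
Variables (k : fieldType) (char0 : [pchar k] =i pred0) (lambda : k).
Local Notation H := (heis lambda).
Local Notation Delta := (heis_coproduct lambda char0).
Local Notation eps := (heis_counit lambda).

Lemma heis_counit_gen :
  [/\ eps heisX = 0, eps heisY = 0 & eps heist = 0].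
Proof. exact: heis_lift_gen. Qed.

Lemma heis_coproduct_gen :
  [/\ Delta heisX = heisX ⊗ 1 + 1 ⊗ heisX + heisY ⊗ heist,
      primitive Delta heisY & primitive Delta heist].
Proof. exact: heis_lift_gen. Qed.

Lemma slice_counitM (z z' : tens H H) :
  slice eps (z * z') = slice eps z * slice eps z'.
Proof.
elim/tens_ind: z => [|a b|z1 z2 IH IH']; first by rewrite !(mul0r, linear0).
  elim/tens_ind: z' => [|a' b'|z1 z2 IH IH']; first by rewrite !(mulr0, linear0).
    rewrite tens_pureM !sliceE rmorphM /= -scalerAl -scalerAr.
    by rewrite scalerA.
  by rewrite mulrDr !linearD /= mulrDr IH IH'.
by rewrite mulrDl !linearD /= mulrDl IH IH'.
Qed.

(** The left counit axiom, checked on generators and extended multiplicatively. *)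
Lemma slice_counit_coproduct (a : H) : slice eps (Delta a) = a.
Proof.
have [eX eY et] := heis_counit_gen; have [DX DY Dt] := heis_coproduct_gen.
elim/heis_ind: a => [|||c|a b IH IH'|a b IH IH'].
- rewrite DX !linearD /= !sliceE /= eX eY rmorph1.
  by rewrite !scale0r scale1r add0r addr0.
- by rewrite DY !linearD /= !sliceE /= eY rmorph1 scale0r scale1r add0r.
- by rewrite Dt !linearD /= !sliceE /= et rmorph1 scale0r scale1r add0r.
- by rewrite !linearZ /= rmorph1 sliceE /= rmorph1 scale1r.
- by rewrite !linearD /= IH IH'.
by rewrite rmorphM /= slice_counitM IH IH'.
Qed.

Lemma heis_scalar_inj : injective (fun c : k => c%:A : H).
Proof.
move=> c c' /(congr1 eps); rewrite !linearZ /= rmorph1.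
by rewrite /GRing.scale /= !mulr1.
Qed.

(** * Coefficients of dt and theta in coinvariant forms *)

Section InnerCalculus.
Variables (Omega : fodc H) (theta : Omega).
Variable DeltaR : {linear Omega -> tens Omega H}.
Local Notation X := (heisX : H).
Local Notation Y := (heisY : H).
Local Notation t := (heist : H).
Local Notation d := (diff Omega).
Local Notation basis := [tuple d X; d Y; d t; theta].
Hypothesis basisP : left_basis basis.
Hypothesis cov : right_covariant Delta DeltaR.
Hypothesis inner : forall a, bimod_ad a theta = d a.
Hypothesis theta_coinvariant : coinvariant DeltaR theta.
Local Notation coord := (coord basisP).

(** The bound on [i] selects dt and [theta]. The only basis form that need not be coinvariant is dX,
    and its coaction involves dX and dY alone, so it does not disturb these two coordinates. *)
Lemma slice_coord_cov (i : 'I_4) w :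
  (1 < i)%N -> slice (eps \o coord i) (DeltaR w) = coord i w.
Proof.
move=> i_gt1; have [DX DY Dt] := heis_coproduct_gen.
have Delta1 : Delta 1 = 1 ⊗ 1 by rewrite rmorph1.
have coordM j a : (eps \o coord i) (lact Omega a (tnth basis j)) =
    (i == j)%:R * (eps a : k).
  by rewrite /= coord_lact coord_basis rmorphM /= rmorph_nat mulrC.
rewrite {1}[w](coord_sum basisP) !linear_sum /=.
have term j : slice (eps \o coord i)
    (DeltaR (lact Omega (coord j w) (tnth basis j))) =
    (i == j)%:R *: coord j w.
  rewrite (cov_lact Delta1 cov).
  have [De | jX] : coinvariant DeltaR (tnth basis j) \/ j = ord0.
    case: j => -[|[|[|[|//]]]] lt_j; rewrite (tnth_nth 0) /=.
    - by right; apply: val_inj.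
    - by left; apply: (cov_diff_primitive cov).
    - by left; apply: (cov_diff_primitive cov).
    - by left.
    by rewrite De (slice_lact (coordM j)) slice_counit_coproduct mulr1.
  have De : DeltaR (tnth basis j) = d X ⊗ 1 + d Y ⊗ t.
    rewrite jX (tnth_nth 0) /= cov.2 DX !linearD /= !tens_mapE /=.
    by rewrite diff1 linear0l addr0.
  have j'lt : (1 < 4)%N by [].
  rewrite De linearDr linearD /=.
  have := slice_lact (coordM ord0) (Delta (coord j w)) 1.
  have := slice_lact (coordM (Ordinal j'lt)) (Delta (coord j w)) t.
  rewrite !(tnth_nth 0) /= => -> ->.
  (* Both deltas, at dX and at dY, vanish because [i] exceeds 1. *)
  rewrite jX; case: i i_gt1 coordM => -[|[|i]] //= ilt _ _.
  by rewrite !scale0r addr0.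
rewrite (eq_bigr _ (fun j _ => term j)) (bigD1 i) //= eqxx scale1r.
by rewrite big1 ?addr0 // => j; rewrite eq_sym => /negbTE ->; rewrite scale0r.
Qed.

(** Slicing [w ⊗ 1] yields a scalar multiple of 1. *)
Lemma coord_coinvariant (i : 'I_4) w :
  (1 < i)%N -> coinvariant DeltaR w -> coord i w = (eps (coord i w) : k)%:A.
Proof.
by move=> i_gt1 wP; rewrite -{1}(slice_coord_cov w i_gt1) wP sliceE.
Qed.

Let i0 : 'I_4 := ord0.
Let i1 : 'I_4 := @Ordinal 4 1 isT.
Let i2 : 'I_4 := @Ordinal 4 2 isT.
Let i3 : 'I_4 := @Ordinal 4 3 isT.

Lemma coord_ad4 i p w :
  coord i (bimod_ad p w) =
  coord i0 w * coord i (bimod_ad p (d X)) +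
  coord i1 w * coord i (bimod_ad p (d Y)) +
  coord i2 w * coord i (bimod_ad p (d t)) +
  coord i3 w * coord i (d p) + (coord i w * p - p * coord i w).
Proof.
rewrite coord_ad !big_ord_recl big_ord0 !(tnth_nth 0) /= inner addr0 !addrA.
by do !congr (_ + _); congr (_ * _); congr (_ _ _); apply: val_inj.
Qed.

Lemma coord_gen i :
  [/\ coord i (d X) = (i == i0)%:R, coord i (d Y) = (i == i1)%:R,
      coord i (d t) = (i == i2)%:R & coord i theta = (i == i3)%:R].
Proof.
by split; rewrite -(coord_basis basisP) (tnth_nth 0).
Qed.

(** * Weights under commutation with [Y] *)

Hypothesis lambda_neq0 : lambda != 0.
Hypothesis calc : contains_2d_calculus Omega.

Lemma adXX : bimod_ad X (d X) = 0.
Proof. by case: calc => XX _ _ _; rewrite /bimod_ad XX subrr. Qed.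

Lemma adXY : bimod_ad X (d Y) = (lambda / 2) *: d X.
Proof. by case: calc => _ _ YX _; rewrite /bimod_ad YX addrK. Qed.

Lemma adYX : bimod_ad Y (d X) = - (lambda / 2) *: d X.
Proof.
case: calc => _ XY _ _; rewrite /bimod_ad XY linearBl /= lact_scalar.
by rewrite addrAC subrr add0r scaleNr.
Qed.

Lemma adYY : bimod_ad Y (d Y) = (lambda / 2) *: d Y.
Proof.
case: calc => _ _ _ YY; rewrite /bimod_ad YY linearDl /= lact_scalar.
by rewrite addrAC subrr add0r.
Qed.

(** Differentiate the relation between [Y] and [t]. The extra term shows that dt need not be a
    weight vector. *)
Lemma adYt : bimod_ad Y (d t) = bimod_ad t (d Y) - lambda *: d t.
Proof.
have [_ _ Yt] := heis_relXYt lambda.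
by rewrite -[_ *: d t]linearZ /= -Yt diff_comm opprB addrC subrK.
Qed.

Lemma adYt_weight (w : Omega) m :
  bimod_ad Y w = m *: w ->
  bimod_ad Y (bimod_ad t w) = (m - lambda) *: bimod_ad t w.
Proof.
have [_ _ Yt] := heis_relXYt lambda.
move=> wm; rewrite bimod_ad_ad wm linearZ /= -[t * Y - _]opprB Yt -scaleNr.
by rewrite bimod_ad_scale -scalerDl.
Qed.

Lemma ad_coinvariant p w :
  primitive Delta p -> coinvariant DeltaR w -> coinvariant DeltaR (bimod_ad p w).
Proof. by apply: (coinvariant_ad _ cov) => //; rewrite rmorph1. Qed.

Lemma two_neq0 : (2 : k) != 0.
Proof. by rewrite ((pcharf0P k).1 char0). Qed.

(** Here the weight argument is not yet available, since [[dt, Y]] involves [u = [dY, t]] itself.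
    Comparing coefficients in [[u, Y] = (lambda / 2 - lambda) u] gives two scalar equations
    instead. *)
Lemma theta_adtY : coord i3 (bimod_ad t (d Y)) = 0.
Proof.
have [_ DY Dt] := heis_coproduct_gen.
set u := bimod_ad t (d Y).
have u_coinv : coinvariant DeltaR u.
  by apply: (ad_coinvariant Dt); exact: (cov_diff_primitive cov).
have uY : bimod_ad Y u = (lambda / 2 - lambda) *: u := adYt_weight adYY.
have ut : bimod_ad Y (d t) = u - lambda *: d t := adYt.
clearbody u.
have := coord_coinvariant (i := i2) isT u_coinv.
have := coord_coinvariant (i := i3) isT u_coinv.
set e : k := eps _; set c : k := eps _ => eE cE.
have [X2 Y2 t2 _] := coord_gen i2; have [X3 Y3 t3 _] := coord_gen i3.
(* The dX- and dY-coefficients of [u] may be non-scalar, but [[dX, Y]] and [[dY, Y]] have no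
   component along dt or [theta]. *)
have eqn3 : (lambda / 2 - lambda) * e = c * e.
  apply: heis_scalar_inj; have := coord_ad4 i3 Y u.
  rewrite uY adYX adYY ut linearB !linearZ /= X3 Y3 t3 /= eE cE scalar_comm.
  rewrite !(scaler0, mulr0, add0r, subr0, addr0) /= -!scalerA => ->.
  by rewrite mulr_algl oppr0 scaler0 addr0.
have eqn2 : (lambda / 2 - lambda) * c = c * (c - lambda).
  apply: heis_scalar_inj; have := coord_ad4 i2 Y u.
  rewrite uY adYX adYY ut linearB !linearZ /= X2 Y2 t2 /= cE scalar_comm.
  rewrite !(scaler0, mulr0, add0r, addr0) /= -!scalerA => ->.
  by rewrite mulr_algl scalerN -scalerBl.
rewrite eE; suff -> : e = 0 by rewrite scale0r.
apply/eqP; have := lambda_neq0; apply: contraNT => e_neq0.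
(* With this value [eqn2] reads [c * c = c * (c - lambda)], so [lambda * c = 0], that is
   [lambda ^+ 2 / 2 = 0]. *)
have cE' : c = lambda / 2 - lambda by apply: (mulIf e_neq0).
have lam0 : lambda * (lambda / 2 - lambda) = 0.
  move: eqn2; rewrite cE' => eqn2.
  have -> : lambda * (lambda / 2 - lambda) =
    (lambda / 2 - lambda) * (lambda / 2 - lambda)
    - (lambda / 2 - lambda) * (lambda / 2 - lambda - lambda) by ring.
  by rewrite eqn2 subrr.
have n2 := two_neq0.
have lamE : lambda * (lambda / 2 - lambda) = - (lambda ^+ 2 / 2) by field.
have := lam0; rewrite lamE => /eqP.
rewrite oppr_eq0 mulf_eq0 invr_eq0 (negbTE n2) orbF.
by rewrite expf_eq0.
Qed.

(** Commutators of dX, dY, dt with [Y] have no theta part, [theta] contributes a multiple of dY, and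
    the scalar theta-coefficient of [w] commutes with [Y]. *)
Lemma theta_adY w : coinvariant DeltaR w -> coord i3 (bimod_ad Y w) = 0.
Proof.
move=> wP; have [X3 Y3 t3 _] := coord_gen i3.
rewrite coord_ad4 adYX adYY adYt linearB !linearZ /= X3 Y3 t3 theta_adtY.
rewrite (coord_coinvariant (i := i3) isT wP) scalar_comm.
by rewrite !(scaler0, oppr0, mulr0, addr0, subr0).
Qed.

Lemma theta_weight m w :
  coinvariant DeltaR w -> m != 0 -> bimod_ad Y w = m *: w -> coord i3 w = 0.
Proof.
move=> wP m_neq0 wm; have := theta_adY wP.
by rewrite wm linearZ /= => /eqP; rewrite scaler_eq0 (negbTE m_neq0) => /eqP.
Qed.

(** The weight is [- 3 lambda / 2], nonzero in characteristic zero. *)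
Lemma half_weight_neq0 : - (lambda / 2) - lambda != 0.
Proof.
have n2 := two_neq0; have n3 : (3 : k) != 0 by rewrite ((pcharf0P k).1 char0).
have -> : - (lambda / 2) - lambda = - (3 * lambda / 2) by field.
by rewrite oppr_eq0 !mulf_neq0 ?invr_eq0.
Qed.

Lemma theta_adttY : coord i3 (bimod_ad t (bimod_ad t (d Y))) = 0.
Proof.
have [_ DY Dt] := heis_coproduct_gen.
apply: (theta_weight (m := - (lambda / 2) - lambda)).
- do 2!apply: (ad_coinvariant Dt).
  exact: (cov_diff_primitive cov).
- exact: half_weight_neq0.
- rewrite (adYt_weight (adYt_weight adYY)); congr (_ *: _).
  by have n2 := two_neq0; field.
Qed.

(** The form [[dt, t]] has weight [- 2 lambda] only up to [[[dY, t], t]], whose theta-coefficient is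
    already known to vanish. *)
Lemma theta_adtt : coord i3 (bimod_ad t (d t)) = 0.
Proof.
have [_ DY Dt] := heis_coproduct_gen.
have tt : coinvariant DeltaR (bimod_ad t (d t)).
  by apply: (ad_coinvariant Dt); exact: (cov_diff_primitive cov).
have [_ _ Yt] := heis_relXYt lambda.
have ttY : bimod_ad Y (bimod_ad t (d t)) =
    bimod_ad t (bimod_ad t (d Y)) - (lambda *+ 2) *: bimod_ad t (d t).
  rewrite bimod_ad_ad adYt -[t * Y - _]opprB Yt -[- (_ *: t)]scaleNr.
  rewrite bimod_ad_scale bimod_adB bimod_adZ.
  by rewrite scaleNr -[LHS]addrA -opprD -scalerDl.
have := theta_adY tt; rewrite ttY linearB linearZ /= theta_adttY sub0r.
move/eqP; rewrite oppr_eq0 scaler_eq0 => /orP[|/eqP //].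
by rewrite -mulr_natr mulf_eq0 (negbTE two_neq0) (negbTE lambda_neq0).
Qed.

Lemma theta_adtX : coord i3 (bimod_ad t (d X)) = 0.
Proof.
have [DX DY Dt] := heis_coproduct_gen.
have [_ _ Yt] := heis_relXYt lambda.
(* dX is not coinvariant, but phi is, and it is a weight vector. *)
set phi := d X - ract Omega (d Y) t.
have dXE : d X = phi + ract Omega (d Y) t by rewrite subrK.
have Delta1 : Delta 1 = 1 ⊗ 1 by rewrite rmorph1.
have phiP : coinvariant DeltaR phi.
  rewrite /coinvariant linearB /= (cov_ract Delta1 cov) Dt.
  rewrite (cov_diff_primitive cov DY : DeltaR _ = _) cov.2 DX.
  rewrite linearDr !linearD /= /tens_ract !tens_map2E !tens_mapE /= diff1.
  rewrite ract1 !mul1r linear0l addr0 linearBl /=.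
  by rewrite addrACA subrr addr0.
(* Multiplying dY, of weight [lambda / 2], by [t] lowers the weight by [lambda], to that of dX. *)
have phiY : bimod_ad Y phi = - (lambda / 2) *: phi.
  rewrite bimod_adB adYX bimod_ad_ract adYY.
  rewrite -[t * Y - _]opprB Yt -[- (_ *: t)]scaleNr.
  rewrite linearZl_LR linearZr_LR /= -scalerDl scalerBr; congr (_ - _ *: _).
  by have n2 := two_neq0; field.
clearbody phi.
(* As [t] commutes with itself, [[(dY) t, t] = [dY, t] t = [[dY, t], t] + t [dY, t]], and both terms
   are free of theta; only [[phi, t]] remains. *)
rewrite [bimod_ad t (d X)](congr1 (bimod_ad t) dXE) bimod_adD.
rewrite bimod_ad_ract subrr linear0r addr0 linearD /=.
rewrite ract_ad [X in _ + X]linearD /= coord_lact theta_adttY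
  theta_adtY mulr0 !addr0.
apply: (theta_weight (m := - (lambda / 2) - lambda)).
- exact: (ad_coinvariant Dt).
- exact: half_weight_neq0.
- exact: adYt_weight.
Qed.

(** Differentiate the relation between [X] and [t]: the right side is a multiple of [(dt) t + t dt =
    [dt, t] + 2 t dt]. *)
Lemma theta_adXt : coord i3 (bimod_ad X (d t)) = 0.
Proof.
have [_ Xt _] := heis_relXYt lambda.
have [_ _ t3 _] := coord_gen i3.
have := diff_comm Omega X t; rewrite Xt => /(congr1 (coord i3)).
rewrite linearB /= theta_adtX sub0r linearZ expr2 /= diffM ract_ad linearZ /=.
rewrite -addrA -linearDl /= linearD /= theta_adtt coord_lact t3 mulr0 addr0 scaler0.
by move/eqP; rewrite eq_sym oppr_eq0 => /eqP.
Qed.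

(** * The sub-bimodule spanned by dX, dY and dt *)

Definition theta_free (w : Omega) := coord i3 w = 0.

Lemma theta_free_ad p w :
  theta_free (bimod_ad p (d X)) -> theta_free (bimod_ad p (d Y)) ->
  theta_free (bimod_ad p (d t)) -> theta_free (d p) ->
  theta_free w -> theta_free (ract Omega w p).
Proof.
rewrite /theta_free => pX pY pt dp w0.
rewrite ract_ad linearD /= coord_lact coord_ad4 pX pY pt dp w0.
by rewrite !(mulr0, mul0r, addr0, subr0).
Qed.

Lemma theta_free_ract a w : theta_free w -> theta_free (ract Omega w a).
Proof.
have [X3 Y3 t3 _] := coord_gen i3.
(* The form [w] stays general because the product case applies the second hypothesis to [w a]. *)
elim/heis_ind: a w => [|||c|a b IH IH'|a b IH IH'] w.
- apply: theta_free_ad => //; rewrite /theta_free.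
  + by rewrite adXX linear0.
  + by rewrite adXY linearZ /= X3 scaler0.
  + exact: theta_adXt.
- apply: theta_free_ad => //; rewrite /theta_free.
  + by rewrite adYX linearZ /= X3 scaler0.
  + by rewrite adYY linearZ /= Y3 scaler0.
  + by rewrite adYt linearB linearZ /= theta_adtY t3 scaler0 subr0.
- apply: theta_free_ad => //; rewrite /theta_free.
  + exact: theta_adtX.
  + exact: theta_adtY.
  + exact: theta_adtt.
- by rewrite /theta_free ract_scalar linearZ /= => ->; rewrite scaler0.
- rewrite /theta_free linearDr linearD /= => w0.
  by rewrite (IH _ w0) (IH' _ w0) addr0.
- by rewrite ractM => /IH /IH'.
Qed.

Lemma theta_free_diff a : theta_free (d a).
Proof.
have [X3 Y3 t3 _] := coord_gen i3; rewrite /theta_free.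
elim/heis_ind: a => [|||c|a b IH IH'|a b IH IH'] //.
- by rewrite diff_scalar linear0.
- by rewrite !linearD /= IH IH' addr0.
- by rewrite diffM linearD /= coord_lact (theta_free_ract _ IH) IH' mulr0 addr0.
Qed.

Lemma all_theta_free w : theta_free w.
Proof.
have [s ->] := diff_span w; rewrite /theta_free linear_sum big1 //= => p _.
by rewrite coord_lact theta_free_diff mulr0.
Qed.

(** The form [theta] has theta-coefficient 1, which is nonzero in [H]. *)
Lemma no_2d_calculus : False.
Proof.
have [_ _ _ theta3] := coord_gen i3; have := oner_neq0 H.
by rewrite -[1]theta3 all_theta_free eqxx.
Qed.

End InnerCalculus.
End Heisenberg.

Theorem theorem5p6 (k : fieldType) (char0 : [pchar k] =i pred0)
    (lambda : k) (lambda_neq0 : lambda != 0)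
    (Omega : fodc (heis lambda)) (theta : Omega)
    (DeltaR : {linear Omega -> tens Omega (heis lambda)}) :
  left_basis [tuple diff Omega heisX; diff Omega heisY; diff Omega heist; theta] ->
  right_covariant (heis_coproduct lambda char0) DeltaR ->
  (forall a : heis lambda,
     ract Omega theta a - lact Omega a theta = diff Omega a) ->
  DeltaR theta = theta ⊗ 1 ->
  ~ contains_2d_calculus Omega.
Proof.
move=> basisP cov inner theta_coinvariant calc.
exact: (no_2d_calculus basisP cov inner theta_coinvariant lambda_neq0 calc).
Qed.
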